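(* Let $x^e\in\mathbb R^n$ be given. Suppose that a) the Co-Design problem (defined in the context) is feasible for some $\beta>0$; let $P\succ0$ be the $P$-component of a solution of it, let $\mathcal S=\{\Delta x\in\mathbb R^n:\Delta x^\top P\Delta x\le1\}$, and let $\Delta x^C_{\inf}=\inf_{\Delta x\in\mathcal S}C_1\Delta x$ (entrywise infimum); and b) for every $k=1,\dots,n_\ell$, $$(C_1x^e)_k\ \ge\ \tfrac12\Big(-(\Delta x^C_{\inf})_k+\sqrt{(\Delta x^C_{\inf})_k^2-4p_{\ell k}/(\beta h^{\mathrm o}_{+,k})}\Big).$$ Then the system $$\Delta\dot x(t)=\hat A\big(h(x^e,\Delta x(t))\big)\,\Delta x(t),\qquad \hat A(h)=D^{-1}(A+B_1[h]C_1),$$ is transiently stable with a guaranteed ROA, i.e. the region of attraction of its equilibrium $\Delta x=0$ contains $\Delta\mathcal X^{\mathrm o}=\{\Delta x\in\mathbb R^n:-\Delta\bar x\le\Delta x\le\Delta\bar x\}$.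
   Context: Notation: for a vector $v$, $[v]$ is the diagonal matrix with diagonal $v$; $\oslash$ and $\odot$ are entrywise division and product; inequalities between vectors, and $\inf$, $\sup$ of vectors, are entrywise; $v>0$ means all entries are positive; for symmetric matrices $M\preceq N$ means $N-M$ is positive semidefinite. Setting: $D\in\mathbb R^{n\times n}$ is diagonal with positive diagonal entries; $A\in\mathbb R^{n\times n}$ is the sum of a diagonal matrix with nonpositive diagonal entries and a skew-symmetric matrix; $B_1\in\mathbb R^{n\times n_\ell}$, $C_1=B_1^\top$, and $C_1x$ extracts the $n_\ell$ load bus voltages from the state $x\in\mathbb R^n$ (so $C_1$ selects $n_\ell$ distinct coordinates of $x$); $p_\ell\in\mathbb R^{n_\ell}$ is a constant vector with $p_\ell\le0$; $\Delta\bar x\in\mathbb R^n$, $\Delta\bar x>0$, and $h^{\mathrm o}_+\in\mathbb R^{n_\ell}$, $h^{\mathrm o}_+>0$, are given. The system is the DC microgrid dynamics $D\dot x=Ax+B_2(u\oslash R_s)+B_1(p_\ell\oslash C_1x)$ (with constant input $u$) written in the coordinate $\Delta x=x-x^e$ relative to an equilibrium $x^e$, where $$h(x^e,\Delta x)=-p_\ell\oslash\big(C_1(x^e+\Delta x)\odot C_1x^e\big)\in\mathbb R^{n_\ell},$$ an entry being understood as $0$ when the corresponding entry of $p_\ell$ is $0$. The region of attraction (ROA) of the origin is the set of initial states $\Delta x(0)$ from which the trajectory exists for all future time and converges to $0$, the origin being asymptotically stable. Let $\Delta\mathcal X^{\mathrm o}_1,\dots,\Delta\mathcal X^{\mathrm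 o}_m$ be the vertices of the box $\Delta\mathcal X^{\mathrm o}$. Co-Design problem (for a fixed parameter $\beta>0$): maximize $(\det\hat P)^{1/n}$ over symmetric $P\succ0$, $\hat P\in\mathbb R^{n\times n}$, $\gamma\in\mathbb R^n$ with $\gamma>0$, and $\tau>0$, subject to $$(\Delta\mathcal X^{\mathrm o}_k)^\top[\gamma]\,\Delta\mathcal X^{\mathrm o}_k\le1\ \text{ for an arbitrary (one fixed) } k\in\{1,\dots,m\},\qquad P\preceq[\gamma],\qquad \hat P=PD^{-1},$$ $$\begin{bmatrix}\hat PA+A^\top\hat P^\top+P & \hat PB_1+\tfrac12\beta\tau C_1^\top[h^{\mathrm o}_+]\\ B_1^\top\hat P^\top+\tfrac12\beta\tau[h^{\mathrm o}_+]C_1 & -\tau I\end{bmatrix}\preceq0 .$$ *)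

(* Defs.v *)
From mathcomp Require Import all_boot all_order all_algebra.
From mathcomp Require Import all_classical all_reals all_analysis.

Set Implicit Arguments.
Unset Strict Implicit.
Unset Printing Implicit Defensive.

Import Order.TTheory GRing.Theory Num.Theory.
Import numFieldNormedType.Exports.
Local Open Scope classical_set_scope.
Local Open Scope ring_scope.

Definition diagv (R : realType) (n : nat) (v : 'cV[R]_n) : 'M[R]_n :=
  diag_mx v^T.

Definition posv (R : realType) (n : nat) (v : 'cV[R]_n) : Prop :=
  forall i, 0 < v i 0.

Definition qform (R : realType) (n : nat) (M : 'M[R]_n) (x : 'cV[R]_n) : R :=
  (x^T *m M *m x) 0 0.

Definition psdmx (R : realType) (n : nat) (M : 'M[R]_n) : Prop :=
  M^T = M /\ forall x : 'cV[R]_n, 0 <= qform M x.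

Definition posdefmx (R : realType) (n : nat) (M : 'M[R]_n) : Prop :=
  M^T = M /\ forall x : 'cV[R]_n, x != 0 -> 0 < qform M x.

Definition loewner_le (R : realType) (n : nat) (M N : 'M[R]_n) : Prop :=
  psdmx (N - M).

Definition nonpos_diag_plus_skew (R : realType) (n : nat) (A : 'M[R]_n) : Prop :=
  exists (a : 'cV[R]_n) (K : 'M[R]_n),
    [/\ forall i, a i 0 <= 0, K^T = - K & A = diagv a + K].

(* C x is the subvector of x at the pairwise distinct coordinates sel k. *)
Definition coordinate_selection (R : realType) (m n : nat) (C : 'M[R]_(m, n)) :
  Prop :=
  exists2 sel : 'I_m -> 'I_n, injective sel &
    forall (x : 'cV[R]_n) k, (C *m x) k 0 = x (sel k) 0.

Definition box (R : realType) (n : nat) (xbar : 'cV[R]_n) : set 'cV[R]_n :=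
  [set x | forall i, - xbar i 0 <= x i 0 <= xbar i 0].

(* The m = 2 ^ n vertices of [box xbar] are indexed by sign patterns. *)
Definition box_vertex (R : realType) (n : nat) (xbar : 'cV[R]_n)
    (s : {ffun 'I_n -> bool}) : 'cV[R]_n :=
  \col_i ((-1) ^+ s i * xbar i 0).

(* Autonomous system x' = F x whose right-hand side is defined on U only. A
   trajectory on [0, +oo[ has to stay in U, since the values of F outside U
   (divisions by zero) are meaningless; it is continuous on [0, +oo[ and
   satisfies the equation on ]0, +oo[, hence also at 0 with the right derivative
   when F is continuous on U. *)
Definition trajectory (R : realType) (n : nat) (U : set 'cV[R]_n)
    (F : 'cV[R]_n -> 'cV[R]_n) (x0 : 'cV[R]_n) (x : R -> 'cV[R]_n) : Prop :=
  [/\ x 0 = x0,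
      forall t : R, 0 <= t -> U (x t),
      {within `[0, +oo[, continuous x} &
      forall t : R, 0 < t -> is_derive t (1 : R) x (F (x t))].

(* A trajectory exists for all future time, and every one (it is unique when F
   is locally Lipschitz on an open U) converges to the origin. *)
Definition attracted (R : realType) (n : nat) (U : set 'cV[R]_n)
    (F : 'cV[R]_n -> 'cV[R]_n) : set 'cV[R]_n :=
  [set x0 | (exists x, trajectory U F x0 x) /\
    forall x, trajectory U F x0 x -> x t @[t --> +oo] --> (0 : 'cV[R]_n)].

Definition equilibrium (R : realType) (n : nat) (U : set 'cV[R]_n)
    (F : 'cV[R]_n -> 'cV[R]_n) (x : 'cV[R]_n) : Prop :=
  U x /\ F x = 0.

Definition lyapunov_stable (R : realType) (n : nat) (U : set 'cV[R]_n)
    (F : 'cV[R]_n -> 'cV[R]_n) : Prop :=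
  forall e : R, 0 < e -> exists2 d : R, 0 < d &
    forall x0 : 'cV[R]_n, `|x0| < d ->
      (exists x, trajectory U F x0 x) /\
      (forall x, trajectory U F x0 x -> forall t : R, 0 <= t -> `|x t| < e).

Definition asymptotically_stable (R : realType) (n : nat) (U : set 'cV[R]_n)
    (F : 'cV[R]_n -> 'cV[R]_n) : Prop :=
  [/\ equilibrium U F 0, lyapunov_stable U F &
      exists2 d : R, 0 < d &
        forall x0 : 'cV[R]_n, `|x0| < d -> attracted U F x0].

Definition roa (R : realType) (n : nat) (U : set 'cV[R]_n)
    (F : 'cV[R]_n -> 'cV[R]_n) : set 'cV[R]_n :=
  [set x0 | asymptotically_stable U F /\ attracted U F x0].

(* Since 0 / y = 0, an entry is 0 whenever the entry of pl is. *)
Definition hload (R : realType) (n nl : nat) (C1 : 'M[R]_(nl, n))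
    (pl : 'cV[R]_nl) (xe dx : 'cV[R]_n) : 'cV[R]_nl :=
  \col_k (- (pl k 0 / ((C1 *m (xe + dx)) k 0 * (C1 *m xe) k 0))).

Definition hload_dom (R : realType) (n nl : nat) (C1 : 'M[R]_(nl, n))
    (pl : 'cV[R]_nl) (xe : 'cV[R]_n) : set 'cV[R]_n :=
  [set dx | forall k, pl k 0 != 0 ->
    (C1 *m (xe + dx)) k 0 * (C1 *m xe) k 0 != 0].

Definition Ahat (R : realType) (n nl : nat) (D A : 'M[R]_n)
    (B1 : 'M[R]_(n, nl)) (C1 : 'M[R]_(nl, n)) (h : 'cV[R]_nl) : 'M[R]_n :=
  invmx D *m (A + B1 *m diagv h *m C1).

Definition microgrid_field (R : realType) (n nl : nat) (D A : 'M[R]_n)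
    (B1 : 'M[R]_(n, nl)) (C1 : 'M[R]_(nl, n)) (pl : 'cV[R]_nl)
    (xe dx : 'cV[R]_n) : 'cV[R]_n :=
  Ahat D A B1 C1 (hload C1 pl xe dx) *m dx.

Definition codesign_lmi (R : realType) (n nl : nat) (A : 'M[R]_n)
    (B1 : 'M[R]_(n, nl)) (C1 : 'M[R]_(nl, n)) (hplus : 'cV[R]_nl) (beta : R)
    (P Phat : 'M[R]_n) (tau : R) : 'M[R]_(n + nl) :=
  block_mx
    (Phat *m A + A^T *m Phat^T + P)
    (Phat *m B1 + (2^-1 * beta * tau) *: (C1^T *m diagv hplus))
    (B1^T *m Phat^T + (2^-1 * beta * tau) *: (diagv hplus *m C1))
    (- tau)%:M.

(* Constraints of the co-design problem, for the vertex s of the box. *)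
Definition codesign_feasible (R : realType) (n nl : nat) (D A : 'M[R]_n)
    (B1 : 'M[R]_(n, nl)) (C1 : 'M[R]_(nl, n)) (xbar : 'cV[R]_n)
    (hplus : 'cV[R]_nl) (s : {ffun 'I_n -> bool}) (beta : R)
    (P Phat : 'M[R]_n) (gamma : 'cV[R]_n) (tau : R) : Prop :=
  [/\ posdefmx P, posv gamma & 0 < tau] /\
  [/\ qform (diagv gamma) (box_vertex xbar s) <= 1,
      loewner_le P (diagv gamma),
      Phat = P *m invmx D &
      loewner_le (codesign_lmi A B1 C1 hplus beta P Phat tau) 0].

Definition codesign_objective (R : realType) (n : nat) (Phat : 'M[R]_n) : R :=
  powR (\det Phat) (n%:R^-1).

Definition codesign_maximizer (R : realType) (n nl : nat) (D A : 'M[R]_n)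
    (B1 : 'M[R]_(n, nl)) (C1 : 'M[R]_(nl, n)) (xbar : 'cV[R]_n)
    (hplus : 'cV[R]_nl) (s : {ffun 'I_n -> bool}) (beta : R)
    (P Phat : 'M[R]_n) (gamma : 'cV[R]_n) (tau : R) : Prop :=
  codesign_feasible D A B1 C1 xbar hplus s beta P Phat gamma tau /\
  forall P' Phat' gamma' tau',
    codesign_feasible D A B1 C1 xbar hplus s beta P' Phat' gamma' tau' ->
    codesign_objective Phat' <= codesign_objective Phat.

(* A result about all feasible points covers in particular the maximizers. *)
Lemma codesign_maximizer_feasible (R : realType) (n nl : nat) (D A : 'M[R]_n)
    (B1 : 'M[R]_(n, nl)) (C1 : 'M[R]_(nl, n)) (xbar : 'cV[R]_n)
    (hplus : 'cV[R]_nl) (s : {ffun 'I_n -> bool}) (beta : R)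
    (P Phat : 'M[R]_n) (gamma : 'cV[R]_n) (tau : R) :
  codesign_maximizer D A B1 C1 xbar hplus s beta P Phat gamma tau ->
  codesign_feasible D A B1 C1 xbar hplus s beta P Phat gamma tau.
Proof. by case. Qed.

Definition ellipsoid (R : realType) (n : nat) (P : 'M[R]_n) : set 'cV[R]_n :=
  [set dx | qform P dx <= 1].

Definition dxC_inf (R : realType) (n nl : nat) (C1 : 'M[R]_(nl, n))
    (P : 'M[R]_n) : 'cV[R]_nl :=
  \col_k inf [set (C1 *m dx) k 0 | dx in ellipsoid P].

(* Main.v *)
Require Import Defs.
From mathcomp Require Import all_boot all_order all_algebra.
From mathcomp Require Import all_classical all_reals all_analysis.
From mathcomp Require Import ring lra.

Set Implicit Arguments.
Unset Strict Implicit.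
Unset Printing Implicit Defensive.

Import Order.TTheory GRing.Theory Num.Theory.
Import numFieldNormedType.Exports.
Local Open Scope classical_set_scope.
Local Open Scope ring_scope.

(** The form V(x) = x^T P x is a Lyapunov function: along the system V' <= - V
    as long as V <= 1, so the ellipsoid V <= 1 is invariant and V decays like
    exp(-t) along the trajectories in it.

    The decay comes from pairing the matrix inequality with the vector (x, w),
    where w = [h] C1 x is the injection of the loads; this yields
      V' + V + tau * sum_k w_k (beta h+_k (C1 x)_k - w_k) <= 0
    ([lmi_dissipation]). Each summand is nonnegative as soon as
    0 <= h_k <= beta h+_k (a sector condition). On the ellipsoid the voltage
    deviation (C1 x)_k is at least -r_k, with r_k = - (dxC_inf)_k, so that
    h_k <= - p_k / ((a_k - r_k) a_k) with a_k = (C1 xe)_k, and the assumption on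
    xe says exactly that a_k is at least the larger root of
    a (a - r_k) = - p_k / (beta h+_k) ([voltage_margin]).

    The field is singular where a load voltage vanishes, so existence of global
    solutions is obtained for a saturated field, in which (C1 x)_k is replaced
    by its maximum with -r_k. The saturated loads satisfy the same sector
    condition everywhere ([sat_load_sector]) and are globally Lipschitz
    ([sat_load_lipschitz]), hence the saturated system has global solutions
    ([picard_global]); since V decreases along them, those that start in the
    ellipsoid stay there, where the two fields agree. Conversely a trajectory of
    the original system cannot leave the ellipsoid, because V' <= -1 on its
    boundary and V' is continuous ([sublevel_invariant]). The passage from
    these facts to asymptotic stability and the region of attraction is
    [ellipsoid_roa], which is independent of the microgrid.

    The box lies in the ellipsoid because P <= [gamma] and the diagonal form
    [gamma] takes its maximum over the box at every vertex. *)

(** * Scalar differential inequalities *)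

(** The integral is started at -1 so that the fundamental theorem gives its
    derivative at 0 as well; composing with the maximum with 0 then
    gives a function that is continuous on the whole line. *)
Lemma primitive_exists (R : realType) (f : R -> R) :
  continuous f -> exists g : R -> R,
    [/\ continuous g, g 0 = 0 &
        forall t : R, 0 < t -> is_derive t (1 : R) g (f t)].
Proof.
move=> fc; pose J x : R := (\int[lebesgue_measure]_(s in `[-1, x]) f s)%R.
have dJ (t : R) : -1 < t -> is_derive t (1 : R) J (f t).
  move=> t1.
  have fi : lebesgue_measure.-integrable `[-1, (t + 1)] (EFin \o f).
    apply: continuous_compact_integrable; first exact: segment_compact.
    exact: continuous_subspaceT.
  have [||dJt Jt] := @continuous_FTC1 R f (BLeft (-1)) t (t + 1) _ fi _ (fc t).
  - by rewrite ltrDl.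
  - by rewrite lte_fin.
  by apply: DeriveDef => //; rewrite -derive1E.
have cmax : continuous (fun t : R => Num.max t 0).
  by move=> t; apply: continuous_max; [exact: cvg_id|exact: cvg_cst].
exists (fun t => J (Num.max t 0) - J 0); split.
- move=> t; apply: cvgB; last exact: cvg_cst.
  apply: continuous_cvg; last exact: cmax.
  have mt : -1 < Num.max t 0 by rewrite lt_max ltrN10 orbT.
  apply/differentiable_continuous/derivable1_diffP.
  by have [] := dJ _ mt.
- by rewrite maxxx subrr.
- move=> t t0.
  apply: (@near_eq_is_derive _ _ _ (fun t => J t - J 0)).
  + near=> s; have s0 : 0 < s by near: s; exact: lt_nbhsr.
    by rewrite max_l // ltW.
  + have t1 : -1 < t by rewrite (lt_trans _ t0) // ltrN10.
    by have := is_deriveB (dJ _ t1) (is_derive_cst (J 0) t 1); rewrite subr0.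
Unshelve. all: by end_near. Qed.

Lemma le_of_derive_le (R : realType) (f g f' g' : R -> R) :
    {within `[0, +oo[, continuous f} -> {within `[0, +oo[, continuous g} ->
    (forall t : R, 0 < t -> is_derive t (1 : R) f (f' t)) ->
    (forall t : R, 0 < t -> is_derive t (1 : R) g (g' t)) ->
    (forall t, 0 < t -> f' t <= g' t) -> f 0 <= g 0 ->
  forall t, 0 <= t -> f t <= g t.
Proof.
move=> cf cg df dg fg fg0 t; rewrite le_eqVlt => /predU1P[<-//|t0].
have sub : `[0, t] `<=` `[0, +oo[.
  by move=> s /=; rewrite !in_itv/= => /andP[-> _].
have [||c] := @MVT R (g - f) (g' - f') 0 t t0.
- move=> x; rewrite in_itv/= => /andP[x0 _].
  by apply: is_deriveB; [exact: dg|exact: df].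
- apply: (continuous_subspaceW sub) => x.
  by apply: cvgB; [exact: cg|exact: cf].
rewrite in_itv/= => /andP[c0 _]; rewrite !fctE subr0 => e.
suff : 0 <= (g' c - f' c) * t by rewrite -e; lra.
by apply: mulr_ge0 (ltW t0); rewrite subr_ge0 fg.
Qed.

(** The product of f and exp is nonincreasing. *)
Lemma exp_decay (R : realType) (f f' : R -> R) :
    {within `[0, +oo[, continuous f} ->
    (forall t : R, 0 < t -> is_derive t (1 : R) f (f' t)) ->
    (forall t, 0 < t -> f' t <= - f t) ->
  forall t, 0 <= t -> f t <= f 0 * expR (- t).
Proof.
move=> cf df ff t t0.
have cexp : {within `[(0:R), +oo[, continuous (@expR R)}.
  exact/continuous_subspaceT/continuous_expR.
suff : expR t * f t <= f 0.
  by rewrite -ler_pdivlMl ?expR_gt0 // expRN mulrC.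
apply: (@le_of_derive_le R (expR * f) (cst (f 0))
          (fun s => expR s *: f' s + f s *: expR s) (cst 0)) => //.
- by move=> x; apply: cvgM; [exact: cexp|exact: cf].
- by move=> x; exact: cvg_cst.
- by move=> s s0; have := df s s0 => ?; exact: is_deriveM.
- move=> s s0 /=; rewrite /GRing.scale/= mulrC -mulrDl.
  by rewrite pmulr_lle0 ?expR_gt0 // -lerBrDr sub0r ff.
- by rewrite !fctE expR0 mul1r.
Qed.

Lemma within_itvcy_eps (R : realType) (f : R -> R) (a : R) :
    {within `[0, +oo[, continuous f} -> 0 <= a -> forall e, 0 < e ->
  exists2 d, 0 < d & forall s, 0 <= s -> `|a - s| < d -> `|f a - f s| < e.
Proof.
move=> /subspace_continuousP cf a0 e e0.
have /cvgrPdist_lt /(_ e e0) : f @ within `[0, +oo[ (nbhs a) --> f a.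
  by apply: cf; rewrite /= in_itv/= a0.
rewrite near_withinE => -[d /= d0 dP]; exists d => // s s0 sd.
by apply: dP => //=; rewrite in_itv/= s0.
Qed.

(** A function that exceeds c at t has a last time in [0, t] at which it is at
    most c. At that time it equals c and its derivative is negative, hence it
    is still at most c shortly afterwards. The derivative is known on ]0, +oo[
    only, so the case where the last time is 0 uses the continuity of f'. *)
Lemma sublevel_invariant (R : realType) (f f' : R -> R) (c : R) :
    {within `[0, +oo[, continuous f} -> {within `[0, +oo[, continuous f'} ->
    (forall t : R, 0 < t -> is_derive t (1 : R) f (f' t)) ->
    (forall t, 0 <= t -> f t = c -> f' t < 0) -> f 0 <= c ->
  forall t, 0 <= t -> f t <= c.
Proof.
move=> cf cf' df f'lt f0 t t0; rewrite leNgt; apply/negP => ct.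
pose E := [set s | 0 <= s <= t /\ f s <= c].
have E0 : E 0 by split; rewrite ?lexx.
have Et : ubound E t by move=> s [/andP[]].
have hE : has_sup E by split; [exists 0|exists t].
have [m0 mt] : 0 <= sup E /\ sup E <= t.
  split; first by apply: ub_le_sup => //; exists t.
  by apply: ge_sup => //; exists 0.
have Em : f (sup E) <= c.
  rewrite leNgt; apply/negP => cm.
  have [|d d0 dP] := within_itvcy_eps cf m0 (e := f (sup E) - c).
    by rewrite subr_gt0.
  have [s [/andP[s0 st] fs] ms] := sup_adherent d0 hE.
  have sm : s <= sup E by apply: ub_le_sup; [exists t|rewrite /E/= s0 st].
  have := dP s s0; rewrite ger0_norm ?subr_ge0 // ltr_norml; lra.
have mlt : sup E < t.
  by rewrite lt_neqAle mt andbT; apply: contraTneq ct => <-; rewrite -leNgt.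
suff [s [ms st fs]] : exists s, [/\ sup E < s, s <= t & f s <= c].
  have : s <= sup E.
    apply: ub_le_sup; first by exists t.
    by split => //; rewrite st andbT (le_trans m0) // ltW.
  by rewrite leNgt ms.
have step d : 0 < d -> exists s, [/\ sup E < s, s <= t & s - sup E < d].
  move=> d0; exists (Num.min t (sup E + d / 2)); split.
  - by rewrite lt_min mlt ltrDl divr_gt0.
  - by rewrite ge_min lexx.
  - by rewrite ltrBlDl gt_min ltrD2l [X in _ || X](_ : _ = true) ?orbT //; lra.
move: Em; rewrite le_eqVlt => /predU1P[fm|fm].
- have f'm := f'lt _ m0 fm.
  have [|d d0 dP] := within_itvcy_eps cf' m0 (e := - f' (sup E)).
    by rewrite oppr_gt0.
  have [s [ms st sd]] := step d d0; exists s; split => //.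
  have sub : `[sup E, s] `<=` `[0, +oo[.
    by move=> x /=; rewrite !in_itv/= => /andP[/(le_trans m0) ->].
  have [||x] := @MVT R f f' (sup E) s ms.
  + move=> x; rewrite in_itv/= => /andP[mx _]; apply: df.
    exact: le_lt_trans mx.
  + exact: continuous_subspaceW sub cf.
  rewrite in_itv/= => /andP[mx xs] e.
  have f'x : f' x < 0.
    have := dP x (le_trans m0 (ltW mx)).
    rewrite ltr0_norm ?subr_lt0 // ltr_norml; lra.
  have : f' x * (s - sup E) <= 0 by rewrite nmulr_rle0 // subr_ge0 ltW.
  by rewrite -e fm subr_le0.
- have [|d d0 dP] := within_itvcy_eps cf m0 (e := c - f (sup E)).
    by rewrite subr_gt0.
  have [s [ms st sd]] := step d d0; exists s; split => //.
  have := dP s (le_trans m0 (ltW ms)).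
  rewrite ltr0_norm ?subr_lt0 // ltr_norml; lra.
Qed.

(** With the weight exp(2 L t), integrating an L-Lipschitz right-hand side
    halves the error on all of [0, +oo[ at once, because the derivative of the
    weight is 2 L times the weight. This makes the Picard
    iteration converge geometrically. *)
Lemma exp_weight_halving (R : realType) (f f' : R -> R) (c L : R) :
    0 <= c -> {within `[0, +oo[, continuous f} -> f 0 = 0 ->
    (forall t : R, 0 < t -> is_derive t (1 : R) f (f' t)) ->
    (forall t, 0 < t -> `|f' t| <= L * (c * expR (2 * L * t))) ->
  forall t, 0 <= t -> `|f t| <= c / 2 * expR (2 * L * t).
Proof.
move=> c0 cf f0 df f'le t t0.
pose g (s : R) := c / 2 * expR (2 * L * s).
have dg (s : R) : is_derive s (1 : R) g (L * (c * expR (2 * L * s))).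
  rewrite /g; apply: is_derive_eq.
  by rewrite /GRing.scale/=; field.
have cg : {within `[0, +oo[, continuous g}.
  apply: continuous_subspaceT => s; apply/differentiable_continuous.
  by apply/derivable1_diffP; have [] := dg s.
have g0 : 0 <= g 0 by rewrite mulr_ge0 ?divr_ge0 ?expR_ge0.
rewrite ler_norml lerNl; apply/andP; split.
- apply: (@le_of_derive_le _ (- f) g (- f') _ _ cg _ (fun t _ => dg t)) => //.
  + by move=> x; apply: cvgN; exact: cf.
  + by move=> s s0; have := df s s0 => ?; exact: is_deriveN.
  + by move=> s s0; rewrite (le_trans _ (f'le s s0)) // -normrN ler_norm.
  + by rewrite !fctE f0 oppr0.
- apply: (@le_of_derive_le _ f g f' _ cf cg df (fun t _ => dg t)) => //.
  + by move=> s s0; rewrite (le_trans _ (f'le s s0)) // ler_norm.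
  + by rewrite f0.
Qed.

(** * Column vectors *)

Lemma col_norm_leP (R : realType) (n : nat) (x : 'cV[R]_n) (e : R) :
  0 <= e -> (`|x| <= e) <-> forall i, `|x i 0| <= e.
Proof.
move=> e0; rewrite [`|x|]/Num.Def.normr/= mx_normrE; split=> [xe i|xe].
- by apply: le_trans xe; exact: (le_bigmax _ _ (i, 0)).
- by apply: bigmax_le => // -[i j] _; rewrite (ord1 j).
Qed.

Lemma col_coord_le (R : realType) (n : nat) (x : 'cV[R]_n) i :
  `|x i 0| <= `|x|.
Proof. exact: (col_norm_leP x (normr_ge0 x)).1. Qed.

Lemma mulmx_norm_le (R : realType) (m n : nat) (M : 'M[R]_(m, n))
    (x : 'cV[R]_n) :
  `|M *m x| <= n%:R * `|M| * `|x|.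
Proof.
apply/col_norm_leP; first by rewrite !mulr_ge0.
move=> i; rewrite mxE (le_trans (ler_norm_sum _ _ _)) //.
rewrite -mulrA mulr_natl -[n in _ *+ n]card_ord -sumr_const ler_sum // => j _.
rewrite normrM ler_pM //; last exact: col_coord_le.
by rewrite [leRHS]/Num.Def.normr/= mx_normrE; exact: (le_bigmax _ _ (i, j)).
Qed.

Lemma col_cvg (R : realType) (n : nat) (T : Type) (F : set_system T)
    {FF : Filter F} (f : T -> 'cV[R]_n) (l : 'cV[R]_n) :
  (forall i, f t i 0 @[t --> F] --> l i 0) -> f @ F --> l.
Proof.
move=> fl; apply/cvgrPdist_le => e e0.
near=> t; apply/(col_norm_leP _ (ltW e0)) => i; rewrite !mxE.
move: i; near: t; apply: filter_forall => i.
exact: ((cvgrPdist_le _ _).1 (fl i)).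
Unshelve. all: by end_near. Qed.

Lemma coord_cvg (R : realType) (n : nat) (T : Type) (F : set_system T)
    {FF : Filter F} (f : T -> 'cV[R]_n) (l : 'cV[R]_n) i :
  f @ F --> l -> f t i 0 @[t --> F] --> l i 0.
Proof.
move=> fl; apply: (@continuous_cvg _ _ _ F FF f (fun M : 'cV[R]_n => M i 0) l).
  exact: coord_continuous.
exact: fl.
Qed.

Lemma mulmx_cvg (R : realType) (m n : nat) (M : 'M[R]_(m, n)) (T : Type)
    (F : set_system T) {FF : Filter F} (f : T -> 'cV[R]_n) (l : 'cV[R]_n) :
  f @ F --> l -> M *m f t @[t --> F] --> M *m l.
Proof.
move=> fl; apply: col_cvg => i; rewrite mxE; under eq_fun do rewrite mxE.
apply: cvg_big => [|j _]; first exact: add_continuous.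
by apply: cvgM; [exact: cvg_cst|exact: coord_cvg].
Qed.

Lemma col_is_deriveP (R : realType) (n : nat) (x : R -> 'cV[R]_n) (t : R)
    (dx : 'cV[R]_n) :
  is_derive t (1 : R) x dx <->
  forall i, is_derive t (1 : R) (fun s => x s i 0) (dx i 0).
Proof.
split=> [[xt <-] i|dxt].
- apply: DeriveDef; first exact: (derivable_mxP x t 1).1.
  by rewrite derive_mx // mxE.
- have xt : derivable x t 1.
    by apply/derivable_mxP => i j; rewrite (ord1 j); case: (dxt i).
  apply: DeriveDef => //; rewrite derive_mx //.
  by apply/colP => i; rewrite mxE; case: (dxt i).
Qed.

Lemma col_primitive_exists (R : realType) (n : nat) (f : R -> 'cV[R]_n)
    (x0 : 'cV[R]_n) :
  continuous f -> exists g : R -> 'cV[R]_n,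
    [/\ continuous g, g 0 = x0 &
        forall t : R, 0 < t -> is_derive t (1 : R) g (f t)].
Proof.
move=> cf.
have prim i : exists g : R -> R, [/\ continuous g, g 0 = 0 &
    forall t : R, 0 < t -> is_derive t (1 : R) g (f t i 0)].
  apply: primitive_exists => t.
  by apply: coord_cvg; exact: cf.
pose g i := sval (cid (prim i)).
exists (fun t => x0 + \col_i g i t); split.
- move=> t; apply: cvgD; first exact: cvg_cst.
  apply: col_cvg => i; rewrite mxE; under eq_fun do rewrite mxE.
  by rewrite /g; case: (cid _) => h [/= + _ _]; exact.
- apply/colP => i; rewrite !mxE /g.
  by case: (cid _) => h [/= _ -> _]; rewrite addr0.
- move=> t t0; apply/col_is_deriveP => i; under eq_fun do rewrite !mxE.
  rewrite -[f t i 0]add0r.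
  by apply: is_deriveD; rewrite /g; case: (cid _) => h [/= _ _]; exact.
Qed.

Lemma col_exp_weight_halving (R : realType) (n : nat) (u u' : R -> 'cV[R]_n)
    (c L : R) :
    0 <= c -> continuous u -> u 0 = 0 ->
    (forall t : R, 0 < t -> is_derive t (1 : R) u (u' t)) ->
    0 <= L ->
    (forall t, 0 < t -> `|u' t| <= L * (c * expR (2 * L * t))) ->
  forall t, 0 <= t -> `|u t| <= c / 2 * expR (2 * L * t).
Proof.
move=> c0 cu u0 du L0 u'le t t0.
apply/col_norm_leP; first by rewrite mulr_ge0 ?divr_ge0 ?expR_ge0.
move=> i; apply: (@exp_weight_halving _ (fun s => u s i 0) (fun s => u' s i 0)).
- by [].
- apply: continuous_subspaceT => s.
  by apply: coord_cvg; exact: cu.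
- by rewrite u0 mxE.
- by move=> s s0; move: (du s s0) => /col_is_deriveP.
- by move=> s s0; rewrite (le_trans (col_coord_le _ _)) // u'le.
- by [].
Qed.

(** The intervals of radius 2 c / 2^k around u k are nested; the limit is the
    supremum of their left end points. *)
Lemma geometric_limit (R : realType) (u : nat -> R) (c : R) :
  (forall k, `|u k.+1 - u k| <= c / 2 ^+ k) ->
  exists l, forall k, `|l - u k| <= 2 * c / 2 ^+ k.
Proof.
move=> uc; have p2 k : (2:R) ^+ k != 0 by rewrite expf_neq0.
have step k : u k - 2 * c / 2 ^+ k <= u k.+1 - 2 * c / 2 ^+ k.+1 /\
    u k.+1 + 2 * c / 2 ^+ k.+1 <= u k + 2 * c / 2 ^+ k.
  have -> : 2 * c / 2 ^+ k.+1 = c / 2 ^+ k by rewrite exprS; field.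
  rewrite -mulrA; have := uc k; rewrite ler_norml; lra.
have c0 : 0 <= c by have := le_trans (normr_ge0 _) (uc 0%N);
  rewrite expr0 divr1.
have lo j k : (j <= k)%N -> u j - 2 * c / 2 ^+ j <= u k - 2 * c / 2 ^+ k.
  elim: k => [|k ih]; first by rewrite leqn0 => /eqP->.
  rewrite leq_eqVlt => /predU1P[->//|/ih] h.
  exact: le_trans h (step k).1.
have hi j k : (j <= k)%N -> u k + 2 * c / 2 ^+ k <= u j + 2 * c / 2 ^+ j.
  elim: k => [|k ih]; first by rewrite leqn0 => /eqP->.
  rewrite leq_eqVlt => /predU1P[->//|/ih]; apply: le_trans.
  exact: (step k).2.
have mid j k : u j - 2 * c / 2 ^+ j <= u k + 2 * c / 2 ^+ k.
  have pos m : 0 <= 2 * c / 2 ^+ m by rewrite divr_ge0 ?mulr_ge0 ?exprn_ge0.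
  have [jk|/ltnW kj] := leqP j k.
  - by have := lo _ _ jk; have := pos k; lra.
  - by have := hi _ _ kj; have := pos j; lra.
pose E := range (fun k => u k - 2 * c / 2 ^+ k).
have Eub k : ubound E (u k + 2 * c / 2 ^+ k) by move=> _ [j _ <-].
exists (sup E) => k; rewrite ler_norml.
have h1 : u k - 2 * c / 2 ^+ k <= sup E.
  by apply: ub_le_sup; [exists (u k + 2 * c / 2 ^+ k)|exists k].
have h2 : sup E <= u k + 2 * c / 2 ^+ k.
  by apply: ge_sup => //; exists (u 0%N - 2 * c / 2 ^+ 0); exists 0%N.
lra.
Qed.

Lemma col_geometric_limit (R : realType) (n : nat) (u : nat -> 'cV[R]_n)
    (c : R) :
  (forall k, `|u k.+1 - u k| <= c / 2 ^+ k) ->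
  exists l, forall k, `|l - u k| <= 2 * c / 2 ^+ k.
Proof.
move=> uc.
have c0 : 0 <= c by have := le_trans (normr_ge0 _) (uc 0%N);
  rewrite expr0 divr1.
have lim i : exists l, forall k, `|l - u k i 0| <= 2 * c / 2 ^+ k.
  apply: geometric_limit => k; apply: le_trans (uc k).
  by have := col_coord_le (u k.+1 - u k) i; rewrite !mxE.
exists (\col_i sval (cid (lim i))) => k; apply/col_norm_leP.
  by rewrite divr_ge0 ?mulr_ge0 ?exprn_ge0.
by move=> i; rewrite !mxE; case: (cid _) => /=.
Qed.

(** * Global solutions of Lipschitz differential equations *)

Lemma lipschitz_continuous (R : realType) (n : nat)
    (F : 'cV[R]_n -> 'cV[R]_n) (L : R) :
  0 < L -> (forall x y, `|F x - F y| <= L * `|x - y|) -> continuous F.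
Proof.
move=> L0 FL x A /nbhs_ballP[e e0 eA]; apply/nbhs_ballP.
exists (e / L); first exact: divr_gt0.
move=> y; rewrite mx_norm_ball /ball_/= ltr_pdivlMr // mulrC => xy.
by apply: eA; rewrite mx_norm_ball; exact: le_lt_trans (FL x y) xy.
Qed.

(** Picard iteration. By [exp_weight_halving] the iterates X k satisfy
    |X (k+1) t - X k t| <= c exp(2 L t) / 2^(k+1), so they converge locally
    uniformly to a continuous x. The Picard image z of x differs from X (k+1) by
    at most c exp(2 L t) / 2^(k+1), by the same estimate; hence z = x on
    [0, +oo[. *)
Theorem picard_global (R : realType) (n : nat) (F : 'cV[R]_n -> 'cV[R]_n)
    (L : R) (x0 : 'cV[R]_n) :
    0 < L -> (forall x y, `|F x - F y| <= L * `|x - y|) ->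
  exists x : R -> 'cV[R]_n, [/\ continuous x, x 0 = x0 &
    forall t : R, 0 < t -> is_derive t (1 : R) x (F (x t))].
Proof.
move=> L0 FL; have cF := lipschitz_continuous L0 FL.
pose solves (x y : R -> 'cV[R]_n) := [/\ continuous y, y 0 = x0 &
  forall t : R, 0 < t -> is_derive t (1 : R) y (F (x t))].
have exists_step x : continuous x -> exists y, solves x y.
  move=> cx; apply: (@col_primitive_exists _ _ (fun t => F (x t))) => t.
  exact: (cvg_comp _ _ (cx t) (cF (x t))).
(* The Picard image of x; the default value is never met on continuous x. *)
pose step x := xget x (solves x).
have stepP x : continuous x -> solves x (step x).
  by move=> /exists_step; exact: xgetPex.
pose X k := iter k step (cst x0).
have cX k : continuous (X k).
  elim: k => [|k ih] /=; first by move=> t; exact: cvg_cst.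
  by have [] := stepP _ ih.
have X0 k : X k 0 = x0.
  by case: k => [//|k] /=; have [] := stepP _ (cX k).
have dX k (t : R) : 0 < t -> is_derive t (1 : R) (X k.+1) (F (X k t)).
  by have [_ _] := stepP _ (cX k); exact.
(* c is large enough for the derivative F x0 of X 1 to be at most L c. *)
pose c := `|F x0| / L; pose w (t : R) := expR (2 * L * t).
have c0 : 0 <= c by rewrite divr_ge0 // ltW.
have w1 t : 0 <= t -> 1 <= w t.
  by move=> t0; rewrite -expR0 ler_expR !mulr_ge0 // ltW.
have X_step k t : 0 <= t -> `|X k.+1 t - X k t| <= c / 2 ^+ k.+1 * w t.
  elim: k t => [|k ih] t t0.
    apply: (@col_exp_weight_halving _ _ (fun t => X 1%N t - X 0%N t)
      (fun=> F x0) c L) => //.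
    - by move=> s; apply: cvgB; [exact: cX|exact: cX].
    - by rewrite !X0 subrr.
    - move=> s s0; rewrite -[F x0]subr0.
      by apply: is_deriveB; exact: (dX 0%N).
    - exact: ltW.
    - move=> s s0; rewrite mulrA mulrCA divff ?gt_eqF // mulr1.
      by rewrite ler_peMr // w1 // ltW.
  rewrite exprSr invfM mulrA.
  apply: (@col_exp_weight_halving _ _ (fun t => X k.+2 t - X k.+1 t)
    (fun t => F (X k.+1 t) - F (X k t)) (c / 2 ^+ k.+1) L) => //.
  - by rewrite divr_ge0 ?exprn_ge0.
  - by move=> s; apply: cvgB; [exact: cX|exact: cX].
  - by rewrite !X0 subrr.
  - by move=> s s0; apply: is_deriveB; exact: dX.
  - exact: ltW.
  - by move=> s s0; rewrite (le_trans (FL _ _)) // ler_pM2l // ih // ltW.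
have lim t : exists l, forall k,
    `|l - X k (Num.max t 0)| <= c * w (Num.max t 0) / 2 ^+ k.
  have t0 : 0 <= Num.max t 0 by rewrite le_max lexx orbT.
  have [|l lP] := @col_geometric_limit _ _ (fun k => X k (Num.max t 0))
      (c * w (Num.max t 0) / 2).
    move=> k; rewrite (le_trans (X_step k _ t0)) // exprS invfM.
    by rewrite le_eqVlt; apply/orP; left; apply/eqP; ring.
  exists l => k; rewrite (le_trans (lP k)) // le_eqVlt; apply/orP; left.
  by apply/eqP; field; rewrite expf_neq0.
pose x t := sval (cid (lim t)).
have xX k t : 0 <= t -> `|x t - X k t| <= c * w t / 2 ^+ k.
  by move=> t0; rewrite /x; case: (cid _) => l /= /(_ k); rewrite max_l.
have small (b e : R) : 0 <= b -> 0 < e -> exists k, b / 2 ^+ k <= e.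
  move=> b0 e0; have b1 : 0 < b + 1 by rewrite ltr_wpDl.
  have eb : 0 < e / (b + 1) by rewrite divr_gt0.
  have [k /=] := filter_ex (near_infty_natSinv_expn_lt (PosNum eb)).
  rewrite mul1r ltr_pdivlMr // => /ltW kP; exists k.
  by rewrite mulrC (le_trans _ kP) // ler_wpM2l ?invr_ge0 ?exprn_ge0 // lerDl.
have w_ge0 t : 0 <= c * w t by rewrite mulr_ge0 ?expR_ge0.
have cx : continuous x.
  move=> t; apply/cvgrPdist_le => e e0; have e3 : 0 < e / 3 by rewrite divr_gt0.
  (* T bounds the weight on the neighbourhood s <= t + 1 of t. *)
  pose T := Num.max t 0 + 1.
  have [k kP] := small (c * w T) (e / 3) (w_ge0 T) e3.
  have near_lim s : s <= t + 1 -> `|x s - X k (Num.max s 0)| <= e / 3.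
    move=> st; apply: le_trans kP; rewrite /x; case: (cid _) => l /= /(_ k) h.
    apply: le_trans h _; rewrite ler_pM2r ?invr_gt0 ?exprn_gt0 //.
    rewrite ler_wpM2l // /w ler_expR ler_pM2l ?mulr_gt0 //.
    by rewrite /T; case: (leP s 0); case: (leP t 0); lra.
  have cXmax : X k (Num.max s 0) @[s --> t] --> X k (Num.max t 0).
    have cmax : Num.max s 0 @[s --> t] --> Num.max t 0.
      by apply: continuous_max; [exact: cvg_id|exact: cvg_cst].
    exact: (cvg_comp _ _ cmax (cX k (Num.max t 0))).
  near=> s.
  have h1 := near_lim t; have h2 : `|x s - X k (Num.max s 0)| <= e / 3.
    by apply: near_lim; apply: ltW; near: s; apply: lt_nbhsl; rewrite ltrDl.
  have h3 : `|X k (Num.max t 0) - X k (Num.max s 0)| <= e / 3.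
    by near: s; exact: cvgr_dist_le cXmax _ e3.
  rewrite (_ : x t - x s = x t - X k (Num.max t 0) +
    (X k (Num.max t 0) - X k (Num.max s 0)) - (x s - X k (Num.max s 0))).
    rewrite (le_trans (ler_normB _ _)) // (_ : e = e / 3 + e / 3 + e / 3).
      rewrite lerD // (le_trans (ler_normD _ _)) // lerD // h1 //.
      by rewrite lerDl.
    by field.
  by rewrite opprB !subrKA.
have [z [cz z0 dz]] := exists_step x cx.
suff zx t : 0 <= t -> z t = x t.
  by exists z; split => // t t0; rewrite zx ?ltW //; exact: dz.
move=> t0.
have zX k : `|z t - X k.+1 t| <= c * w t / 2 ^+ k.+1.
  rewrite exprSr invfM mulrA.
  have -> : c * w t / 2 ^+ k / 2 = c / 2 ^+ k / 2 * w t by ring.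
  apply: (@col_exp_weight_halving _ _ (fun t => z t - X k.+1 t)
    (fun t => F (x t) - F (X k t)) (c / 2 ^+ k) L) => //.
  - by rewrite divr_ge0 ?exprn_ge0.
  - by move=> s; apply: cvgB; [exact: cz|exact: cX].
  - by rewrite z0 !X0 subrr.
  - by move=> s s0; apply: is_deriveB; [exact: dz|exact: dX].
  - exact: ltW.
  - move=> s s0; rewrite (le_trans (FL _ _)) // ler_pM2l // mulrAC.
    by rewrite xX // ltW.
apply/eqP; rewrite -subr_eq0 -normr_le0; apply/ler_addgt0Pl => e e0.
rewrite addr0.
have e2 : 0 < e / 2 by rewrite divr_gt0.
have [k kP] := small (c * w t) (e / 2) (w_ge0 t) e2.
have kP' : c * w t / 2 ^+ k.+1 <= e / 2.
  apply: le_trans kP; rewrite exprS invfM mulrCA ler_piMl ?invf_le1 ?ler1n //.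
  by rewrite divr_ge0 ?exprn_ge0.
rewrite (_ : z t - x t = z t - X k.+1 t - (x t - X k.+1 t)).
  rewrite (splitr e) (le_trans (ler_normB _ _)) // lerD //.
    exact: le_trans (zX k) kP'.
  exact: le_trans (xX k.+1 t t0) kP'.
by rewrite opprB subrKA.
Unshelve. all: by end_near. Qed.

(** * Positive definite quadratic forms *)

Definition bform (R : realType) (n : nat) (M : 'M[R]_n) (x y : 'cV[R]_n) : R :=
  (x^T *m M *m y) 0 0.

Lemma bform_sumE (R : realType) (n : nat) (M : 'M[R]_n) (x y : 'cV[R]_n) :
  bform M x y = \sum_i \sum_j x i 0 * M i j * y j 0.
Proof.
rewrite /bform -mulmxA mxE; apply: eq_bigr => i _.
by rewrite !mxE big_distrr /=; apply: eq_bigr => j _; rewrite mulrA.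
Qed.

Lemma bformC (R : realType) (n : nat) (M : 'M[R]_n) (x y : 'cV[R]_n) :
  M^T = M -> bform M x y = bform M y x.
Proof.
move=> MT; rewrite /bform -[in LHS](trmxK (x^T *m M *m y)) mxE.
by rewrite !trmx_mul trmxK MT mulmxA.
Qed.

Lemma bform_lincombl (R : realType) (n : nat) (M : 'M[R]_n)
    (x y z : 'cV[R]_n) (a b : R) :
  bform M (a *: x + b *: y) z = a * bform M x z + b * bform M y z.
Proof.
by rewrite /bform linearD !linearZ /= !mulmxDl -!scalemxAl !mxE.
Qed.

Lemma qform_lincomb (R : realType) (n : nat) (M : 'M[R]_n) (x y : 'cV[R]_n)
    (a b : R) : M^T = M ->
  qform M (a *: x + b *: y) =
  a ^+ 2 * qform M x + 2 * a * b * bform M x y + b ^+ 2 * qform M y.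
Proof.
move=> MT; have yx := bformC y x MT.
rewrite -![qform _ _]/(bform _ _ _) bform_lincombl !(bformC _ (_ + _)) //.
by rewrite !bform_lincombl yx; ring.
Qed.

Lemma posdef_qform_ge0 (R : realType) (n : nat) (P : 'M[R]_n) (x : 'cV[R]_n) :
  posdefmx P -> 0 <= qform P x.
Proof.
move=> [_ P0]; have [->|/P0/ltW//] := eqVneq x 0.
by rewrite /qform mulmx0 mxE.
Qed.

(** The form is nonnegative at (y, y) x - (x, y) y. *)
Lemma cauchy_schwarz_posdef (R : realType) (n : nat) (P : 'M[R]_n)
    (x y : 'cV[R]_n) :
  posdefmx P -> bform P x y ^+ 2 <= qform P x * qform P y.
Proof.
move=> PD; have [PT P0] := PD; have [->|y0] := eqVneq y 0.
  by rewrite /qform /bform !mulmx0 mxE expr0n mulr0.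
have q0 := P0 y y0; set b := bform P x y.
have : 0 <= qform P (qform P y *: x + (- b) *: y).
  exact: posdef_qform_ge0.
rewrite qform_lincomb // -/b => h.
have {h} : 0 <= qform P y * (qform P x * qform P y - b ^+ 2).
  by rewrite (le_trans h) // le_eqVlt; apply/orP; left; apply/eqP; ring.
by rewrite pmulr_rge0 // subr_ge0.
Qed.

Lemma posdef_unitmx (R : realType) (n : nat) (P : 'M[R]_n) :
  posdefmx P -> P \in unitmx.
Proof.
move=> [PT P0]; rewrite unitmxE unitfE; apply/negP => /det0P[v v0 vP].
have := P0 v^T; rewrite /qform trmxK vP mul0mx mxE ltxx.
by rewrite -trmx0 (inj_eq trmx_inj) => /(_ v0).
Qed.

(** Coercivity without compactness: the coordinate x i is the P-inner product of
    x with P^-1 e_i, so Cauchy-Schwarz bounds it. *)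
Lemma coord_sqr_le_posdef (R : realType) (n : nat) (P : 'M[R]_n) :
  posdefmx P -> exists2 K : R, 0 < K &
    forall (x : 'cV[R]_n) i, x i 0 ^+ 2 <= K * qform P x.
Proof.
move=> PD; have [PT P0] := PD; have Pu := posdef_unitmx PD.
have q_ge0 x := posdef_qform_ge0 x PD.
pose d i : 'cV[R]_n := invmx P *m delta_mx i 0.
exists (1 + \sum_i qform P (d i)).
  by rewrite ltr_pwDl // sumr_ge0.
move=> x i; have -> : x i 0 = bform P (d i) x.
  rewrite /bform /d trmx_mul trmx_inv PT -!mulmxA mulKmx //.
  by rewrite trmx_delta -rowE mxE.
apply: le_trans (cauchy_schwarz_posdef _ _ PD) _.
rewrite ler_wpM2r // (bigD1 i) //= addrCA lerDl addr_ge0 //.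
by rewrite sumr_ge0.
Qed.

Lemma bform_cvg (R : realType) (n : nat) (M : 'M[R]_n) (T : Type)
    (F : set_system T) {FF : Filter F} (f g : T -> 'cV[R]_n) (a b : 'cV[R]_n) :
  f @ F --> a -> g @ F --> b -> bform M (f t) (g t) @[t --> F] --> bform M a b.
Proof.
move=> fa gb; rewrite bform_sumE; under eq_fun do rewrite bform_sumE.
apply: cvg_big => [|i _]; first exact: add_continuous.
apply: cvg_big => [|j _]; first exact: add_continuous.
apply: cvgM; last exact: coord_cvg.
by apply: cvgM; [exact: coord_cvg|exact: cvg_cst].
Qed.

Lemma qform_is_derive (R : realType) (n : nat) (M : 'M[R]_n)
    (x : R -> 'cV[R]_n) (dx : 'cV[R]_n) (t : R) : M^T = M ->
  is_derive t (1 : R) x dx ->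
  is_derive t (1 : R) (fun s => qform M (x s)) (2 * bform M (x t) dx).
Proof.
move=> MT /col_is_deriveP xd.
have -> : (fun s => qform M (x s)) =
    \sum_i \sum_j (fun s => x s i 0 * M i j * x s j 0).
  apply/funext => s; rewrite -[qform _ _]/(bform _ _ _) bform_sumE fct_sumE.
  by apply: eq_bigr => i _; rewrite fct_sumE.
have -> : 2 * bform M (x t) dx =
    \sum_i \sum_j (x t i 0 * M i j * dx j 0 + dx i 0 * M i j * x t j 0).
  rewrite mulr_natl mulr2n [X in _ + X]bformC // !bform_sumE -big_split /=.
  by apply: eq_bigr => i _; rewrite -big_split.
apply: is_derive_sum => i; apply: is_derive_sum => j.
have xi := xd i; have xj := xd j.
apply: is_derive_eq; rewrite /GRing.scale /=; ring.
Qed.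

(** * Regions of attraction from a quadratic Lyapunov function *)

Lemma trajectory_in_ellipsoid (R : realType) (n : nat) (P : 'M[R]_n)
    (U : set 'cV[R]_n) (F : 'cV[R]_n -> 'cV[R]_n) (x0 : 'cV[R]_n)
    (x : R -> 'cV[R]_n) :
    P^T = P -> (forall y, U y -> F z @[z --> y] --> F y) ->
    (forall y, ellipsoid P y -> 2 * bform P y (F y) <= - qform P y) ->
    trajectory U F x0 x -> ellipsoid P x0 ->
  forall t, 0 <= t -> ellipsoid P (x t).
Proof.
move=> PT cF dec [x00 Ux cx dx] x0P.
apply: (@sublevel_invariant _ (fun t => qform P (x t))
  (fun t => 2 * bform P (x t) (F (x t)))).
- by move=> t; apply: bform_cvg; exact: cx.
- apply/subspace_continuousP => t; rewrite /= in_itv/= andbT => t0.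
  have cxt : x @ within `[0, +oo[ (nbhs t) --> x t.
    by move/subspace_continuousP : cx; apply; rewrite /= in_itv/= t0.
  apply: cvgM; first exact: cvg_cst.
  apply: bform_cvg => //.
  exact: (cvg_comp _ _ cxt (cF _ (Ux t t0))).
- by move=> t t0; apply: qform_is_derive => //; exact: dx.
- move=> t t0 Vt; rewrite (le_lt_trans (dec _ _)) ?Vt ?oppr_lt0 //.
  by rewrite /ellipsoid /= Vt.
- by rewrite x00.
Qed.

Lemma trajectory_exp_decay (R : realType) (n : nat) (P : 'M[R]_n)
    (U : set 'cV[R]_n) (F : 'cV[R]_n -> 'cV[R]_n) (x0 : 'cV[R]_n)
    (x : R -> 'cV[R]_n) :
    P^T = P ->
    (forall y, ellipsoid P y -> 2 * bform P y (F y) <= - qform P y) ->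
    trajectory U F x0 x -> (forall t, 0 <= t -> ellipsoid P (x t)) ->
  forall t, 0 <= t -> qform P (x t) <= qform P x0 * expR (- t).
Proof.
move=> PT dec [x00 Ux cx dx] Px t t0; rewrite -x00.
apply: (@exp_decay _ (fun t => qform P (x t))
  (fun t => 2 * bform P (x t) (F (x t)))) => //.
- by move=> s; apply: bform_cvg; exact: cx.
- by move=> s s0; apply: qform_is_derive => //; exact: dx.
- by move=> s s0; apply: dec; apply: Px; exact: ltW.
Qed.

(** F is defined on U only and need not be Lipschitz there. The globally
    Lipschitz field Fs serves for the existence of solutions, while F itself
    controls every trajectory that starts in the ellipsoid. *)
Theorem ellipsoid_roa (R : realType) (n : nat) (P : 'M[R]_n)
    (U : set 'cV[R]_n) (F Fs : 'cV[R]_n -> 'cV[R]_n) (L : R) :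
    posdefmx P -> 0 < L -> (forall x y, `|Fs x - Fs y| <= L * `|x - y|) ->
    (forall x, 2 * bform P x (Fs x) <= - qform P x) ->
    (forall x, ellipsoid P x -> U x /\ F x = Fs x) ->
    (forall x, U x -> F y @[y --> x] --> F x) -> F 0 = 0 ->
  asymptotically_stable U F /\ ellipsoid P `<=` roa U F.
Proof.
move=> PD L0 FsL Fsdec FFs cF F0; have [PT P0] := PD.
have [K K0 PK] := coord_sqr_le_posdef PD.
have q0 : qform P 0 = 0 by rewrite /qform mulmx0 mxE.
have Fdec y : ellipsoid P y -> 2 * bform P y (F y) <= - qform P y.
  by move=> /FFs[_ ->]; exact: Fsdec.
have ex x0 : ellipsoid P x0 -> exists x, trajectory U F x0 x.
  move=> Px0; have [x [cx x00 dx]] := picard_global x0 L0 FsL.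
  have trs : trajectory setT Fs x0 x.
    by split => //; exact: continuous_subspaceT.
  have Px t : 0 <= t -> ellipsoid P (x t).
    apply: (trajectory_in_ellipsoid PT _ _ trs Px0) => // y _.
    exact: (lipschitz_continuous L0 FsL).
  exists x; split => //.
  - by move=> t t0; have [] := FFs _ (Px t t0).
  - exact: continuous_subspaceT.
  - by move=> t t0; rewrite (FFs _ (Px t (ltW t0))).2; exact: dx.
have bound x0 x t i : ellipsoid P x0 -> trajectory U F x0 x -> 0 <= t ->
    x t i 0 ^+ 2 <= K * (qform P x0 * expR (- t)).
  move=> Px0 tr t0; rewrite (le_trans (PK _ _)) // ler_pM2l //.
  apply: (trajectory_exp_decay PT Fdec tr) => //.
  exact: trajectory_in_ellipsoid PT cF Fdec tr Px0.
have att x0 : ellipsoid P x0 -> attracted U F x0.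
  move=> Px0; split; first exact: ex.
  move=> x tr; apply/cvgrPdist_le => e e0.
  have e2 : 0 < e ^+ 2 by rewrite exprn_gt0.
  have lim : K * qform P x0 * expR (- t) @[t --> +oo] --> (0 : R).
    rewrite -(mulr0 (K * qform P x0)).
    by apply: cvgM; [exact: cvg_cst|exact: cvgr_expR].
  near=> t; have t0 : 0 <= t by near: t; exact: nbhs_pinfty_ge.
  rewrite sub0r normrN; apply/(col_norm_leP _ (ltW e0)) => i.
  rewrite -(ler_pXn2r (ltn0Sn 1)) ?nnegrE ?(ltW e0) // real_normK ?num_real //.
  rewrite (le_trans (bound _ _ _ i Px0 tr t0)) // mulrA.
  rewrite (le_trans (ler_norm _)) // -normrN -sub0r.
  by near: t; move/cvgrPdist_le : lim; exact.
(* Small initial states have small energy, and energy controls the norm. *)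
have nbhd (r : R) : 0 < r -> exists2 d : R, 0 < d &
    forall x0 : 'cV[R]_n, `|x0| < d -> qform P x0 < r.
  move=> r0.
  have cq : qform P y @[y --> (0 : 'cV[R]_n)] --> (0 : R).
    rewrite -[X in _ --> X]q0.
    pose N0 := nbhs (0 : 'cV[R]_n).
    by apply: (@bform_cvg _ _ P _ N0 _ id id 0 0); exact: cvg_id.
  have := cq _ (nbhsx_ballx (0 : R) r r0).
  rewrite -nbhs_ballE => -[d /= d0 dP]; exists d => // x0 xd.
  have : ball (0 : 'cV[R]_n) d x0 by rewrite mx_norm_ball /ball_/= sub0r normrN.
  move=> /dP /=; rewrite /ball /= sub0r normrN.
  exact: le_lt_trans (ler_norm _).
have [d1 d10 d1P] := nbhd 1 ltr01.
have stab : asymptotically_stable U F.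
  split.
  - by split => //; apply: (FFs 0 _).1; rewrite /ellipsoid/= q0 ler01.
  - move=> e e0; have r0 : 0 < e ^+ 2 / 4 / K by rewrite !divr_gt0 // exprn_gt0.
    have [d d0 dP] := nbhd _ r0.
    exists (Num.min d d1); first by rewrite lt_min d0.
    move=> x0; rewrite lt_min => /andP[/dP x0d /d1P /ltW x01].
    split; first exact: ex.
    move=> x tr t t0.
    (* The coordinate bounds are not strict, hence e / 2 in place of e. *)
    suff : `|x t| <= e / 2 by move=> /le_lt_trans; apply; lra.
    have e20 : 0 <= e / 2 by lra.
    apply/(col_norm_leP _ e20) => i.
    rewrite -(ler_pXn2r (ltn0Sn 1)) ?nnegrE // real_normK ?num_real //.
    apply: le_trans (bound _ _ _ i x01 tr t0) _.
    rewrite (_ : (e / 2) ^+ 2 = K * (e ^+ 2 / 4 / K)); last first.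
      by field; rewrite gt_eqF.
    rewrite ler_pM2l // -[leRHS]mulr1; apply: ler_pM.
    + exact: posdef_qform_ge0.
    + exact: expR_ge0.
    + exact: ltW.
    + by rewrite -expR0 ler_expR oppr_le0.
  - by exists d1 => // x0 /d1P /ltW; exact: att.
by split => // x0 Px0; split => //; exact: att.
Unshelve. all: by end_near. Qed.

(** * Saturated constant power loads *)

(** The injection h y of a load of power p at equilibrium voltage a, where
    h = - p / ((a + y) a), with the voltage deviation y cut off below at -r.
    Both occurrences of y are cut off, so below -r the function is constant. *)
Definition sat_load (R : realType) (p a r y : R) : R :=
  - (p / ((a + Num.max y (- r)) * a)) * Num.max y (- r).

(** For p nonzero the saturated injection equals - p c / ((a + c) a) with
    c >= -r; the difference of two values is
    - p (c - d) / ((a + c) (a + d)), and both factors are at least a - r. *)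
Lemma sat_load_lipschitz (R : realType) (p a r y z : R) :
    (p != 0 -> 0 <= r < a) ->
  `|sat_load p a r y - sat_load p a r z| <= `|p| / (a - r) ^+ 2 * `|y - z|.
Proof.
rewrite /sat_load; have [-> _|_ /(_ isT)/andP[r0 ra]] := eqVneq p 0.
  by rewrite normr0 !mul0r oppr0 !mul0r subrr normr0.
set c := Num.max y _; set d := Num.max z _.
have cr : a - r <= a + c by rewrite lerD2l le_max lexx orbT.
have dr : a - r <= a + d by rewrite lerD2l le_max lexx orbT.
have cd : `|c - d| <= `|y - z|.
  rewrite /c /d; case: (leP y (-r)); case: (leP z (-r)) => h1 h2.
  - by rewrite subrr normr0.
  - by rewrite !ltr0_norm ?subr_lt0 //; lra.
  - by rewrite !gtr0_norm ?subr_gt0 //; lra.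
  - by [].
rewrite (_ : _ - _ = (- p) / ((a + c) * (a + d)) * (c - d)); last first.
  by field; rewrite !gt_eqF //; lra.
have c0 : 0 < a + c by lra.
have d0 : 0 < a + d by lra.
have ar0 : 0 < a - r by lra.
rewrite normrM ler_pM // normrM normrN ler_wpM2l // ger0_norm; last first.
  by rewrite invr_ge0 mulr_ge0 ?ltW.
by rewrite lef_pV2 ?posrE ?mulr_gt0 ?exprn_gt0 // expr2 ler_pM // ltW.
Qed.

(** The injection is h c with 0 <= h <= H. Below the cut-off c = -r lies between
    y and 0, so the sector 0 <= w (H y - w) still holds. *)
Lemma sat_load_sector (R : realType) (p a r H y : R) :
    p <= 0 -> 0 <= r -> 0 < H -> (p != 0 -> r < a /\ - p / H <= a * (a - r)) ->
  0 <= sat_load p a r y * (H * y - sat_load p a r y).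
Proof.
rewrite /sat_load => p0 r0 H0.
have [-> _|_ /(_ isT)[ra pa]] := eqVneq p 0.
  by rewrite !mul0r oppr0 !mul0r.
set c := Num.max y _; set h := - (p / _).
have cr : - r <= c by rewrite le_max lexx orbT.
have c0 : 0 < (a + c) * a by rewrite mulr_gt0 //; lra.
have h0 : 0 <= h by rewrite /h -mulNr divr_ge0 ?oppr_ge0 // ltW.
have hH : h <= H.
  rewrite /h -mulNr ler_pdivrMr // mulrC -ler_pdivrMr //.
  rewrite (le_trans pa) // mulrC ler_pM2r //; lra.
rewrite -mulrA mulr_ge0 //.
rewrite /c; case: (leP y (- r)) => yr.
- rewrite mulr_le0 //; first by lra.
  rewrite mulrN opprK.
  have : H * y <= H * (- r) by rewrite ler_pM2l.
  have : h * r <= H * r by rewrite ler_wpM2r.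
  lra.
- rewrite -mulrBl mulrCA mulr_ge0 ?subr_ge0 //.
  by rewrite -expr2 sqr_ge0.
Qed.

(** The lower bound on a is the larger root of a^2 - r a + p / H, which exceeds r
    when p < 0. *)
Lemma voltage_margin (R : realType) (p a r H : R) :
    p <= 0 -> 0 <= r -> 0 < H ->
    2^-1 * (r + Num.sqrt (r ^+ 2 - 4 * p / H)) <= a ->
  p != 0 -> r < a /\ - p / H <= a * (a - r).
Proof.
move=> p0 r0 H0 ra pn0.
have pH : 0 < - p / H by rewrite divr_gt0 // oppr_gt0 lt_neqAle pn0.
set s := Num.sqrt _ in ra.
have arg : r ^+ 2 < r ^+ 2 - 4 * p / H.
  by rewrite -[4 * p / H]mulrA -mulrN -mulNr ltrDl mulr_gt0.
have s2 : s ^+ 2 = r ^+ 2 + 4 * (- p / H).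
  rewrite sqr_sqrtr; last by rewrite (le_trans _ (ltW arg)) // sqr_ge0.
  by rewrite !mulNr mulrN mulrA.
have s0 : 0 <= s := sqrtr_ge0 _.
have rs : r < s by rewrite -(ltr_pXn2r (ltn0Sn 1)) ?nnegrE // s2; lra.
split; first by lra.
have : s ^+ 2 <= (2 * a - r) ^+ 2.
  by rewrite ler_pXn2r ?nnegrE //; lra.
rewrite s2; nra.
Qed.

(** * Dissipation from the matrix inequality *)

(** The left-hand side is the quadratic form of the matrix at (x, w). *)
Lemma lmi_dissipation (R : realType) (n nl : nat) (D A : 'M[R]_n)
    (B1 : 'M[R]_(n, nl)) (C1 : 'M[R]_(nl, n)) (h : 'cV[R]_nl) (beta tau : R)
    (P Phat : 'M[R]_n) (x : 'cV[R]_n) (w : 'cV[R]_nl) :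
    Phat = P *m invmx D ->
    loewner_le (codesign_lmi A B1 C1 h beta P Phat tau) 0 ->
  2 * bform P x (invmx D *m (A *m x + B1 *m w)) + qform P x +
    tau * \sum_k w k 0 * (beta * h k 0 * (C1 *m x) k 0 - w k 0) <= 0.
Proof.
move=> PhatE [_ /(_ (col_mx x w))].
have tr11 (X : 'M[R]_1) : X^T = X by apply/matrixP => i j; rewrite !ord1 mxE.
rewrite /qform sub0r mulmxN mulNmx mxE oppr_ge0; apply: le_trans.
rewrite /codesign_lmi tr_col_mx mul_row_block mul_row_col.
pose g := x^T *m Phat *m A *m x; pose g' := x^T *m Phat *m B1 *m w.
pose q := w^T *m diagv h *m C1 *m x.
have gT : x^T *m (A^T *m Phat^T) *m x = g.
  by rewrite -[RHS]tr11 /g !trmx_mul trmxK !mulmxA.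
have g'T : w^T *m (B1^T *m Phat^T) *m x = g'.
  by rewrite -[RHS]tr11 /g' !trmx_mul trmxK !mulmxA.
have qT : x^T *m (C1^T *m diagv h) *m w = q.
  by rewrite -[RHS]tr11 /q !trmx_mul trmxK tr_diag_mx !mulmxA.
have qE : q 0 0 = \sum_k w k 0 * (h k 0 * (C1 *m x) k 0).
  rewrite /q -!mulmxA mxE; apply: eq_bigr => k _.
  by rewrite /diagv mul_diag_mx !mxE.
have wE : (w^T *m w) 0 0 = \sum_k w k 0 * w k 0.
  by rewrite mxE; apply: eq_bigr => k _; rewrite mxE.
have -> : \sum_k w k 0 * (beta * h k 0 * (C1 *m x) k 0 - w k 0) =
    beta * q 0 0 - (w^T *m w) 0 0.
  rewrite qE wE mulr_sumr -sumrB; apply: eq_bigr => k _; ring.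
have -> : bform P x (invmx D *m (A *m x + B1 *m w)) = g 0 0 + g' 0 0.
  by rewrite /bform /g /g' PhatE mulmxDr mulmxDr !mulmxA mxE.
rewrite !(mulmxDr, mulmxDl) gT g'T !(=^~ scalemxAr, =^~ scalemxAl) qT.
rewrite !mulmxA -/g -/g' -/q mul_mx_scalar -scalemxAl.
rewrite !mxE le_eqVlt; apply/orP; left; apply/eqP.
by field.
Qed.

(** * The microgrid *)

Lemma qform_diagv (R : realType) (n : nat) (g x : 'cV[R]_n) :
  qform (diagv g) x = \sum_i g i 0 * x i 0 ^+ 2.
Proof.
rewrite /qform -mulmxA mxE; apply: eq_bigr => i _.
by rewrite /diagv mul_diag_mx !mxE expr2 mulrCA.
Qed.

(** The form of [gamma] depends on the squares of the coordinates only, so it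
    has the same value at all vertices, and this value is its maximum over the
    box. *)
Lemma box_sub_ellipsoid (R : realType) (n : nat) (P : 'M[R]_n)
    (gamma xbar : 'cV[R]_n) (s : {ffun 'I_n -> bool}) :
    posv gamma -> loewner_le P (diagv gamma) ->
    qform (diagv gamma) (box_vertex xbar s) <= 1 ->
  box xbar `<=` ellipsoid P.
Proof.
move=> gamma0 [_ Pg] vertex x xB; rewrite /ellipsoid /=.
have Pgx : qform P x <= qform (diagv gamma) x.
  have := Pg x; rewrite /qform mulmxBr mulmxBl [X in 0 <= X]mxE.
  by rewrite [X in _ + X]mxE subr_ge0.
apply: le_trans Pgx (le_trans _ vertex); rewrite !qform_diagv.
apply: ler_sum => i _; rewrite ler_pM2l // mxE exprMn sqrr_sign mul1r.
by rewrite -[leLHS]real_normK ?num_real // ler_sqr ?nnegrE // ?ler_norml //;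
  have := xB i; lra.
Qed.

(** The infimum is a true lower bound because the ellipsoid is bounded; it is
    nonpositive because the ellipsoid contains 0. *)
Lemma dxC_inf_bounds (R : realType) (n nl : nat) (C1 : 'M[R]_(nl, n))
    (P : 'M[R]_n) k :
  posdefmx P -> coordinate_selection C1 ->
  dxC_inf C1 P k 0 <= 0 /\
  forall x, ellipsoid P x -> dxC_inf C1 P k 0 <= (C1 *m x) k 0.
Proof.
move=> PD [sel _ C1E]; have [K K0 PK] := coord_sqr_le_posdef PD.
have lb x : ellipsoid P x -> dxC_inf C1 P k 0 <= (C1 *m x) k 0.
  move=> Px; rewrite mxE; apply: ge_inf; last by exists x.
  exists (- (1 + K)) => _ [y Py <-]; rewrite C1E.
  have : y (sel k) 0 ^+ 2 <= K.
    by apply: le_trans (PK y _) _; rewrite ler_piMr // ltW.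
  by nra.
split=> //; have := lb 0; rewrite mulmx0 [X in _ <= X]mxE; apply.
by rewrite /ellipsoid /= /qform mulmx0 mxE ler01.
Qed.

(** The microgrid field as a function of the injection w of the loads, so that
    the true and the saturated loads are treated alike. *)
Definition load_field (R : realType) (n nl : nat) (D A : 'M[R]_n)
    (B1 : 'M[R]_(n, nl)) (w : 'cV[R]_n -> 'cV[R]_nl) (x : 'cV[R]_n) :
  'cV[R]_n :=
  invmx D *m (A *m x + B1 *m w x).

Lemma microgrid_fieldE (R : realType) (n nl : nat) (D A : 'M[R]_n)
    (B1 : 'M[R]_(n, nl)) (C1 : 'M[R]_(nl, n)) (pl : 'cV[R]_nl)
    (xe x : 'cV[R]_n) :
  microgrid_field D A B1 C1 pl xe x =
  load_field D A B1 (fun x => \col_k (hload C1 pl xe x k 0 * (C1 *m x) k 0)) x.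
Proof.
rewrite /microgrid_field /Ahat /load_field -(mulmxA (invmx D)) mulmxDl -!mulmxA.
congr (_ *m (_ + _ *m _)); apply/colP => k.
by rewrite /diagv mul_diag_mx !mxE.
Qed.

Lemma load_field_cvg (R : realType) (n nl : nat) (D A : 'M[R]_n)
    (B1 : 'M[R]_(n, nl)) (w : 'cV[R]_n -> 'cV[R]_nl) (x : 'cV[R]_n) :
  w y @[y --> x] --> w x ->
  load_field D A B1 w y @[y --> x] --> load_field D A B1 w x.
Proof.
move=> wx; rewrite /load_field.
have h1 : A *m y @[y --> x] --> A *m x.
  exact: (@mulmx_cvg _ _ _ A _ (nbhs x) _ id x cvg_id).
have h2 : B1 *m w y @[y --> x] --> B1 *m w x.
  exact: (@mulmx_cvg _ _ _ B1 _ (nbhs x) _ w (w x) wx).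
exact: (@mulmx_cvg _ _ _ (invmx D) _ (nbhs x) _ _ _ (cvgD h1 h2)).
Qed.

Lemma load_field_lipschitz (R : realType) (n nl : nat) (D A : 'M[R]_n)
    (B1 : 'M[R]_(n, nl)) (w : 'cV[R]_n -> 'cV[R]_nl) (K : R) :
    0 <= K -> (forall x y, `|w x - w y| <= K * `|x - y|) ->
  exists2 L, 0 < L & forall x y,
    `|load_field D A B1 w x - load_field D A B1 w y| <= L * `|x - y|.
Proof.
move=> K0 wK; pose a := n%:R * `|A|; pose b := nl%:R * `|B1|.
pose d := n%:R * `|invmx D|.
have [a0 b0 d0] : [/\ 0 <= a, 0 <= b & 0 <= d] by rewrite !mulr_ge0.
exists (1 + d * (a + b * K)).
  by rewrite ltr_pwDl // mulr_ge0 // addr_ge0 // mulr_ge0.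
move=> x y; rewrite /load_field -mulmxBr opprD addrACA -!mulmxBr.
rewrite mulrDl mul1r ler_wpDl // (le_trans (mulmx_norm_le _ _)) //.
rewrite -/d -[leRHS]mulrA ler_wpM2l // (le_trans (ler_normD _ _)) //.
rewrite mulrDl lerD //.
  exact: mulmx_norm_le.
by rewrite (le_trans (mulmx_norm_le _ _)) // -/b -[leRHS]mulrA ler_wpM2l.
Qed.

Lemma microgrid_field_cvg (R : realType) (n nl : nat) (D A : 'M[R]_n)
    (B1 : 'M[R]_(n, nl)) (C1 : 'M[R]_(nl, n)) (pl : 'cV[R]_nl)
    (xe x : 'cV[R]_n) :
  hload_dom C1 pl xe x ->
  microgrid_field D A B1 C1 pl xe y @[y --> x] -->
    microgrid_field D A B1 C1 pl xe x.
Proof.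
move=> Ux; rewrite microgrid_fieldE; under eq_fun do rewrite microgrid_fieldE.
apply: load_field_cvg; apply: (@col_cvg _ _ _ (nbhs x)) => k; rewrite mxE.
under eq_fun do rewrite mxE.
have cC : (C1 *m y) k 0 @[y --> x] --> (C1 *m x) k 0.
  apply: (@coord_cvg _ _ _ (nbhs x) _ (fun y => C1 *m y)).
  exact: (@mulmx_cvg _ _ _ C1 _ (nbhs x) _ id x cvg_id).
apply: cvgM => //; rewrite mxE; under eq_fun do rewrite mxE.
have [->|pk] := eqVneq (pl k 0) 0.
  by rewrite mul0r; under eq_fun do rewrite mul0r; exact: cvg_cst.
apply: cvgN; apply: cvgM; first exact: cvg_cst.
apply: cvgV; first exact: Ux.
apply: cvgM; last exact: cvg_cst.
apply: (@coord_cvg _ _ _ (nbhs x) _ (fun y => C1 *m (xe + y))).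
apply: (@mulmx_cvg _ _ _ C1 _ (nbhs x) _ (fun y => xe + y)).
by apply: cvgD; [exact: cvg_cst|exact: cvg_id].
Qed.

Theorem proposition1 (R : realType) (n nl : nat)
    (D A : 'M[R]_n) (B1 : 'M[R]_(n, nl)) (C1 : 'M[R]_(nl, n))
    (pl hplus : 'cV[R]_nl) (dxbar : 'cV[R]_n)
    (n_gt0 : (0 < n)%N)
    (D_diag : is_diag_mx D) (D_pos : forall i, 0 < D i i)
    (A_struct : nonpos_diag_plus_skew A)
    (C1_B1 : C1 = B1^T) (C1_sel : coordinate_selection C1)
    (pl_le0 : forall k, pl k 0 <= 0)
    (dxbar_pos : posv dxbar) (hplus_pos : posv hplus)
    (s : {ffun 'I_n -> bool}) (xe : 'cV[R]_n)
    (beta : R) (beta_gt0 : 0 < beta)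
    (P Phat : 'M[R]_n) (gamma : 'cV[R]_n) (tau : R)
    (P_sol : codesign_feasible D A B1 C1 dxbar hplus s beta P Phat gamma tau)
    (xe_ge : forall k,
      2^-1 * (- dxC_inf C1 P k 0 +
              Num.sqrt (dxC_inf C1 P k 0 ^+ 2 -
                        4 * pl k 0 / (beta * hplus k 0)))
      <= (C1 *m xe) k 0) :
  let U := hload_dom C1 pl xe in
  let F := microgrid_field D A B1 C1 pl xe in
  asymptotically_stable U F /\ box dxbar `<=` roa U F.
Proof.
move=> U F; have [[PD gamma0 tau0] [vertex Pgamma PhatE lmi]] := P_sol.
have boxP := box_sub_ellipsoid gamma0 Pgamma vertex.
pose r k := - dxC_inf C1 P k 0; pose a k := (C1 *m xe) k 0.
have r0 k : 0 <= r k by rewrite oppr_ge0; exact: (dxC_inf_bounds k PD C1_sel).1.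
have yr k x : ellipsoid P x -> - r k <= (C1 *m x) k 0.
  by rewrite opprK; exact: (dxC_inf_bounds k PD C1_sel).2.
have H0 k : 0 < beta * hplus k 0 by rewrite mulr_gt0.
have margin k : pl k 0 != 0 ->
    r k < a k /\ - pl k 0 / (beta * hplus k 0) <= a k * (a k - r k).
  by apply: voltage_margin => //; rewrite sqrrN; exact: xe_ge.
(* Saturation at -r k is invisible on the ellipsoid, by yr. *)
pose w (x : 'cV[R]_n) : 'cV[R]_nl :=
  \col_k sat_load (pl k 0) (a k) (r k) ((C1 *m x) k 0).
pose Fs := load_field D A B1 w.
have [L L0 FsL] : exists2 L, 0 < L &
    forall x y, `|Fs x - Fs y| <= L * `|x - y|.
  pose K k := `|pl k 0| / (a k - r k) ^+ 2.
  have K0 k : 0 <= K k by rewrite divr_ge0 // sqr_ge0.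
  apply: (@load_field_lipschitz _ _ _ D A B1 w
    ((\sum_k K k) * (n%:R * `|C1|))).
    by rewrite !mulr_ge0 // sumr_ge0.
  have subE (u v : 'cV[R]_nl) k : (u - v) k 0 = u k 0 - v k 0 by rewrite !mxE.
  move=> x y; apply/col_norm_leP.
    by rewrite !mulr_ge0 // sumr_ge0.
  move=> k.
  have Cxy : `|(C1 *m x) k 0 - (C1 *m y) k 0| <= n%:R * `|C1| * `|x - y|.
    apply: le_trans (mulmx_norm_le C1 (x - y)).
    have := col_coord_le (C1 *m (x - y)) k.
    by rewrite mulmxBr subE.
  rewrite subE [w x k 0]mxE [w y k 0]mxE.
  apply: le_trans (sat_load_lipschitz _ _ _) _.
    by move=> /margin[ra _]; rewrite r0.
  rewrite -/(K k) -[leRHS]mulrA ler_pM //.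
  by rewrite (bigD1 k) //= lerDl sumr_ge0.
have addE (u v : 'cV[R]_nl) k : (u + v) k 0 = u k 0 + v k 0 by rewrite mxE.
have Fsdec x : 2 * bform P x (Fs x) <= - qform P x.
  have diss := lmi_dissipation x (w x) PhatE lmi.
  have sect : 0 <= tau *
      \sum_k w x k 0 * (beta * hplus k 0 * (C1 *m x) k 0 - w x k 0).
    apply: (mulr_ge0 (ltW tau0)); apply: sumr_ge0 => k _; rewrite [w x k 0]mxE.
    by apply: sat_load_sector => //; exact: margin.
  rewrite /Fs /load_field; lra.
have FFs x : ellipsoid P x -> U x /\ F x = Fs x.
  move=> Px; split=> [k pk|].
    have [ra _] := margin k pk; have h1 := yr k x Px; have h2 := r0 k.
    rewrite mulmxDr addE -/(a k).
    by rewrite mulf_neq0 // gt_eqF //; lra.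
  rewrite /F microgrid_fieldE /Fs /load_field; congr (_ *m (_ + _ *m _)).
  apply/colP => k; rewrite [LHS]mxE [hload _ _ _ _ _ _]mxE [RHS]mxE /sat_load.
  by rewrite mulmxDr addE max_l // yr.
have F0 : F 0 = 0 by rewrite /F /microgrid_field mulmx0.
have cF x : U x -> F y @[y --> x] --> F x by exact: microgrid_field_cvg.
have [stab ell] := ellipsoid_roa PD L0 FsL Fsdec FFs cF F0.
by split => // x xB; apply: ell; exact: boxP.
Qed.
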